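(* Let $p\in\mathbb{C}[z_1,z_2]$ be scattering stable of bidegree $(1,1)$ with $\tilde p(0,0)=0$. If $f=\frac{p+\tilde p}{p-\tilde p}$ is an extreme point of $PRP_2$, then $p$ is $\mathbb{T}^2$-saturated and $p-\tilde p$ is irreducible.
   Context: $\mathbb{D}$ is the open unit disk, $\mathbb{T}$ the unit circle. $PRP_2$ is the convex set of holomorphic functions $f:\mathbb{D}^2\to\{w\in\mathbb{C}:\operatorname{Re}w>0\}$ with $f(0,0)=1$. For $p\in\mathbb{C}[z_1,z_2]$ of bidegree $(n_1,n_2)$ (degree $n_j$ in $z_j$), the reflection is $\tilde p(z)=z_1^{n_1}z_2^{n_2}\overline{p(1/\bar z_1,1/\bar z_2)}$. $p$ is scattering stable if $p$ has no zeros in $\mathbb{D}^2$ and $p,\tilde p$ have no nonconstant common factor. A scattering stable $p$ of bidegree $(n_1,n_2)$ is $\mathbb{T}^2$-saturated if $p$ and $\tilde p$ have $2n_1n_2$ common zeros on $\mathbb{T}^2$, counted with intersection multiplicity, i.e. $\sum_{\zeta\in\mathbb{T}^2}I_\zeta(p,\tilde p)=2n_1n_2$, where $I_\zeta(p,q)=\dim_{\mathbb{C}}\mathcal{O}_\zeta/(p,q)\mathcal{O}_\zeta$ and $\mathcal{O}_\zeta$ is the ring of rational functions with denominators nonvanishing at $\zeta$. *)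

(* Defs.v *)
From HB Require Import structures.
From mathcomp Require Import all_boot all_order all_algebra.
From mathcomp Require Import polyXY fraction.
From mathcomp Require Import complex.
From mathcomp Require Import all_classical all_reals all_analysis.

Set Implicit Arguments.
Unset Strict Implicit.
Unset Printing Implicit Defensive.

Import Order.TTheory GRing.Theory Num.Theory.
Import numFieldNormedType.Exports.

Local Open Scope classical_set_scope.
Local Open Scope ring_scope.

(* C[z_1, z_2] is {poly {poly C}}: z_1 is the outer variable 'X, z_2 is 'Y,
   and p.[z_1, z_2] is evaluation. *)

Section Polynomials.
Variable C : numClosedFieldType.
Implicit Types p q r : {poly {poly C}}.

Definition deg1 p : nat := (size p).-1.
Definition deg2 p : nat := (sizeY p).-1.

Definition has_bidegree p (n1 n2 : nat) : Prop :=
  [/\ p != 0, deg1 p = n1 & deg2 p = n2].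

(* Coefficientwise form of
   z_1^n1 z_2^n2 conj (p (1 / conj z_1, 1 / conj z_2)), where (n1, n2) is the
   bidegree of p; see horner_reflection. *)
Definition reflection p : {poly {poly C}} :=
  \poly_(i < (deg1 p).+1) \poly_(j < (deg2 p).+1)
    (p`_(deg1 p - i)`_(deg2 p - j))^*.

Lemma horner2E p n1 n2 (x y : C) :
  (size p <= n1.+1)%N -> (sizeY p <= n2.+1)%N ->
  p.[x, y] = \sum_(i < n1.+1) \sum_(j < n2.+1) p`_i`_j * y ^+ j * x ^+ i.
Proof.
move=> s1 s2; rewrite (horner_coef_wide _ s1) horner_sum.
apply: eq_bigr => i _; rewrite -polyC_exp hornerM hornerC.
have s3 := leq_trans (max_size_coefXY p i) s2.
by rewrite (horner_coef_wide _ s3) mulr_suml.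
Qed.

Lemma horner_reflection p (x y : C) : x != 0 -> y != 0 ->
  (reflection p).[x, y] =
    x ^+ deg1 p * y ^+ deg2 p * (p.[(x^*)^-1, (y^*)^-1])^*.
Proof.
move=> x0 y0; rewrite (@horner2E p (deg1 p) (deg2 p)) ?leqSpred //.
rewrite (@horner2E _ (deg1 p) (deg2 p)) ?size_poly //; last first.
  rewrite /sizeY; apply/bigmax_leqP => i _; rewrite coef_poly.
  by case: ifP => _; rewrite ?size_poly// size_poly0.
rewrite rmorph_sum mulr_sumr (reindex_inj rev_ord_inj) /=.
apply: eq_bigr => i _; rewrite rmorph_sum mulr_sumr.
rewrite (reindex_inj rev_ord_inj) /=; apply: eq_bigr => j _.
rewrite !subSS coef_poly ltnS leq_subr coef_poly ltnS leq_subr.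
rewrite !subKn -1?ltnS ?ltn_ord//.
rewrite !rmorphM !rmorphXn !fmorphV /= !conjCK.
have xE : x ^+ (deg1 p - i) = x ^+ deg1 p * x^-1 ^+ i.
  by rewrite exprVn expfB_cond// (negbTE x0) add0n -ltnS.
have yE : y ^+ (deg2 p - j) = y ^+ deg2 p * y^-1 ^+ j.
  by rewrite exprVn expfB_cond// (negbTE y0) add0n -ltnS.
by rewrite xE yE !mulrA [RHS](ACl (3*2*4*1*5)).
Qed.

Definition constant2 p : Prop := exists c : C, p = c%:P%:P.

(* The library's %| on {poly _} is pseudo-divisibility, which over the
   coefficient ring {poly C} is not divisibility in C[z_1, z_2]. *)
Definition divides2 q p : Prop := exists r, p = q * r.

Definition no_common_factor p q : Prop :=
  forall r, divides2 r p -> divides2 r q -> constant2 r.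

Definition irreducible2 p : Prop :=
  ~ constant2 p /\ forall q r, p = q * r -> constant2 q \/ constant2 r.

Definition bidisk : set (C * C) := [set z | `|z.1| < 1 /\ `|z.2| < 1].
Definition torus2 : set (C * C) := [set z | `|z.1| = 1 /\ `|z.2| = 1].

Definition scattering_stable p : Prop :=
  (forall z, bidisk z -> p.[z.1, z.2] != 0) /\
  no_common_factor p (reflection p).

Local Notation "x %:F" := (@FracField.tofrac _ x).

Definition local_ring (zeta : C * C) : set {fraction {poly {poly C}}} :=
  [set f | exists a b : {poly {poly C}},
     b.[zeta.1, zeta.2] != 0 /\ f = a%:F / b%:F].

Definition local_ideal (zeta : C * C) p q : set {fraction {poly {poly C}}} :=
  [set f | exists a b, [/\ local_ring zeta a, local_ring zeta b &
     f = a * p%:F + b * q%:F]].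

Definition lin_comb n (c : 'I_n -> C) (e : 'I_n -> {fraction {poly {poly C}}}) :=
  \sum_i (c i)%:P%:P%:F * e i.

(* The classes of the e_i form a C-basis of O_zeta / (p, q) O_zeta. *)
Definition local_quotient_basis (zeta : C * C) p q n
    (e : 'I_n -> {fraction {poly {poly C}}}) : Prop :=
  [/\ forall i, local_ring zeta (e i),
      forall f, local_ring zeta f ->
        exists c, local_ideal zeta p q (f - lin_comb c e) &
      forall c, local_ideal zeta p q (lin_comb c e) -> forall i, c i = 0].

End Polynomials.

Section Analytic.
Variable R : realType.
Local Notation C := R[i].

(* dim_C O_zeta / (p, q) O_zeta, equal to +oo if there is no finite basis *)
Definition intersection_multiplicity (p q : {poly {poly C}}) (zeta : C * C)
    : \bar R :=
  xget +oo%E [set d | exists n (e : 'I_n -> {fraction {poly {poly C}}}),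
    local_quotient_basis zeta p q e /\ d = n%:R%:E].

Definition T2_saturated (p : {poly {poly C}}) : Prop :=
  \esum_(zeta in @torus2 C) intersection_multiplicity p (reflection p) zeta =
  (2 * deg1 p * deg2 p)%N%:R%:E.

(* Complex Frechet differentiability at every point of D *)
Definition holomorphic_on (D : set (C * C)) (f : C * C -> C) : Prop :=
  forall z : C^o * C^o, D z -> differentiable (f : C^o * C^o -> C^o) z.

(* Functions on the bidisk are represented by total functions, of which only
   the values on the bidisk matter. *)
Definition PRP2 : set (C * C -> C) :=
  [set f | [/\ holomorphic_on (@bidisk C) f,
     forall z, bidisk z -> 0 < complex.Re (f z) & f (0, 0) = 1]].

Definition extreme_point_on (D : set (C * C)) (S : set (C * C -> C))
    (f : C * C -> C) : Prop :=
  S f /\ forall (g h : C * C -> C) (t : R), S g -> S h -> 0 < t < 1 ->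
    (forall z, D z -> f z = (t%:C)%C * g z + ((1 - t)%:C)%C * h z) ->
    forall z, D z -> g z = f z /\ h z = f z.

End Analytic.

(* Main.v *)
(* Since p~(0,0) = 0, p = a + b z_1 + c z_2, and stability means
   |b| + |c| <= |a|. Conversely this inequality alone gives |p~| < |p| on the
   bidisk, so that f = (p + p~)/(p - p~) lies in PRP_2. Replacing (b, c) by
   (b +- al, c +- conj al) adds +- (al z_1 + conj al z_2) to p and p~, keeps
   p - p~, and exhibits f as a midpoint; hence f is not extreme as soon as some
   al <> 0 preserves the inequality for both signs. A small real al works if
   |b| + |c| < |a|. If |b| + |c| = |a| and p - p~ is reducible, its 2 x 2
   coefficient determinant vanishes, i.e. |b - conj c| = |a| = |b| + |c|; then b
   and - conj c have the same argument t, and al = e t with e small works.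
   Finally, if |a| = |b| + |c|, then p~ restricted to the line p = 0 is a
   quadratic with a double root, at the only point of T^2 on that line. *)
Require Import Defs.
From mathcomp Require Import all_boot all_order all_algebra.
From mathcomp Require Import polyXY fraction.
From mathcomp Require Import complex.
From mathcomp Require Import all_classical all_reals all_analysis.
From mathcomp Require Import ring.

Set Implicit Arguments.
Unset Strict Implicit.
Unset Printing Implicit Defensive.

Import Order.TTheory GRing.Theory Num.Theory.
Import numFieldNormedType.Exports.
Local Open Scope ring_scope.

(** * Polynomials of bidegree (1,1) *)

Section Bilinear.
Variable C : numClosedFieldType.
Implicit Types (p : {poly {poly C}}) (a b c d : C).

Definition bilin a b c d : {poly {poly C}} :=
  (a%:P + c *: 'X)%:P + (b%:P + d *: 'X)%:P * 'X.

Lemma bilinE a b c d x y :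
  (bilin a b c d).[x, y] = a + b * x + c * y + d * x * y.
Proof.
rewrite /bilin /= !hornerE /=; ring.
Qed.

Lemma bilinD a b c d a' b' c' d' :
  bilin a b c d + bilin a' b' c' d' = bilin (a + a') (b + b') (c + c') (d + d').
Proof. by rewrite /bilin !polyCD !scalerDl; ring. Qed.

Lemma bilinN a b c d : - bilin a b c d = bilin (- a) (- b) (- c) (- d).
Proof. by rewrite /bilin !polyCD !polyCN !scaleNr !polyCN; ring. Qed.

Lemma coef_bilin a b c d :
  (bilin a b c d)`_0 = a%:P + c *: 'X /\ (bilin a b c d)`_1 = b%:P + d *: 'X.
Proof. by split; rewrite coefD coefMX !coefC /= ?addr0 ?add0r. Qed.

Lemma coef_linear a b i :
  (a%:P + b *: 'X)`_i = if i == 0 then a else if i == 1 then b else 0.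
Proof.
by rewrite coefD coefZ coefC coefX; case: i => [|[|i]] /=; ring.
Qed.

Lemma bidegree11E p : has_bidegree p 1 1 ->
  p = bilin p`_0`_0 p`_1`_0 p`_0`_1 p`_1`_1.
Proof.
case=> p0; rewrite /deg1 /deg2 => dX dY.
have sX : (size p <= 2)%N by case: (size p) dX => // n <-.
have sY : (sizeY p <= 2)%N by case: (sizeY p) dY => // n <-.
have pE (q : {poly C}) : (size q <= 2)%N -> q = (q`_0)%:P + q`_1 *: 'X.
  move=> sq; apply/polyP => i; rewrite coef_linear.
  case: i => [|[|i]] //=; apply: (leq_sizeP _ _ sq); exact: isT.
have s i := leq_trans (max_size_coefXY p i) sY.
apply/polyP => -[|[|i]]; rewrite ?(coef_bilin _ _ _ _).1 ?(coef_bilin _ _ _ _).2.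
- exact: pE.
- exact: pE.
- rewrite coefD coefMX !coefC /= addr0; exact: (leq_sizeP _ _ sX).
Qed.

Lemma reflection_bidegree11 p : has_bidegree p 1 1 ->
  reflection p = bilin (p`_1`_1)^* (p`_0`_1)^* (p`_1`_0)^* (p`_0`_0)^*.
Proof.
case=> p0 dX dY; rewrite /reflection dX dY.
apply/polyP => -[|[|i]]; rewrite ?(coef_bilin _ _ _ _).1 ?(coef_bilin _ _ _ _).2
  coef_poly /=.
- by apply/polyP => -[|[|j]]; rewrite coef_linear coef_poly.
- by apply/polyP => -[|[|j]]; rewrite coef_linear coef_poly.
- by rewrite coefD coefMX !coefC /= addr0.
Qed.

(** The determinant condition forces degree 1 in z_1, so one of two factors is a polynomial in z_2
    alone. If it were not constant, a root [y] of it would annihilate both [a + c y] and [b + d y],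
    and the determinant would vanish. *)
Lemma bilin_irreducible a b c d : a * d != b * c -> irreducible2 (bilin a b c d).
Proof.
move=> ndet; have [D0 D1] := coef_bilin a b c d.
have noroot y : (a%:P + c *: 'X).[y] = 0 -> (b%:P + d *: 'X).[y] <> 0.
  rewrite !hornerE => e0 e1; case/eqP: ndet.
  have -> : a = - (c * y) by apply/eqP; rewrite -addr_eq0 e0.
  have -> : b = - (d * y) by apply/eqP; rewrite -addr_eq0 e1.
  ring.
have factor_constant q r : bilin a b c d = q * r -> (size r <= 1)%N ->
    constant2 r.
  move=> Dqr /size1_polyC rE.
  have [/eqP|/closed_rootP[y /eqP ry]] := eqVneq (size r`_0) 1.
    by case/size_poly1P => k _ r0E; exists k; rewrite rE r0E.
  by case: (noroot y); rewrite -?D0 -?D1 Dqr rE coefMC hornerM ry mulr0.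
have sD : size (bilin a b c d) = 2%N.
  apply/eqP; rewrite eqn_leq; apply/andP; split; last first.
    rewrite ltnNge; apply: contra ndet => /leq_sizeP/(_ 1 isT).
    rewrite D1 => e; move: (coef_linear b d 0) (coef_linear b d 1).
    by rewrite e !coef0 /= => <- <-; rewrite mulr0 mul0r.
  apply/leq_sizeP => i i2; rewrite coefD coefMX !coefC.
  by case: i i2 => [|[|i]] //= _; rewrite addr0.
split=> [[k kE]|q r Dqr].
  by move: sD; rewrite kE size_polyC; case: (_ == 0).
have q0 : q != 0 by apply/eqP => q0; move: sD; rewrite Dqr q0 mul0r size_poly0.
have r0 : r != 0 by apply/eqP => r0; move: sD; rewrite Dqr r0 mulr0 size_poly0.
have := sD; rewrite Dqr size_mul // => sqr.
have [r1|r1] := leqP (size r) 1; first by right; exact: factor_constant Dqr r1.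
left; apply: (@factor_constant r); first by rewrite Dqr mulrC.
by move: sqr r1; case: (size q) => [|[|m]] //; case: (size r) => [|[|n]] //;
  rewrite !addSn !addnS.
Qed.

End Bilinear.

(** * Local intersection multiplicity along a graph *)

(** Turns a polynomial identity into membership of [a / b] in the ideal generated by [u * x] and
    [y], when [b], [g] and [u] are units of the local ring. *)
Lemma fraction_combination (F : fieldType) (a b g s t u x y : F) :
  b != 0 -> g != 0 -> u != 0 -> a * g = s * x + t * y ->
  a / b = s / (u * b * g) * (u * x) + t / (b * g) * y.
Proof.
move=> b0 g0 u0 e; apply: (mulIf g0); rewrite mulrAC e.
by field; rewrite ?b0 ?g0 ?u0.
Qed.

Lemma fraction_clear (F : fieldType) (r s1 t1 s2 t2 x y : F) :
  t1 != 0 -> t2 != 0 -> r = s1 / t1 * x + s2 / t2 * y ->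
  r * (t1 * t2) = s1 * t2 * x + s2 * t1 * y.
Proof. by move=> t10 t20 ->; field; rewrite ?t10 ?t20. Qed.

Section LocalRing.
Variable C : numClosedFieldType.
Implicit Types (p q A B : {poly {poly C}}) (zeta : C * C).
Implicit Types (f g : {fraction {poly {poly C}}}).
Local Notation "x %:F" := (@FracField.tofrac _ x).

Lemma local_ring_tofrac zeta A : local_ring zeta A%:F.
Proof. by exists A, 1; rewrite !hornerC oner_eq0 tofrac1 divr1. Qed.

Lemma tofrac_neq0 zeta B : B.[zeta.1, zeta.2] != 0 -> B%:F != 0.
Proof. by rewrite tofrac_eq0; apply: contra_neq => ->; rewrite !horner0. Qed.

Lemma local_ringD zeta f g :
  local_ring zeta f -> local_ring zeta g -> local_ring zeta (f + g).
Proof.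
move=> [a [b [b0 ->]]] [a' [b' [b0' ->]]].
exists (a * b' + a' * b), (b * b'); split; first by rewrite !hornerM mulf_neq0.
rewrite tofracD (tofracM a b') (tofracM a' b) (tofracM b b') addf_div //.
  exact: tofrac_neq0 b0.
exact: tofrac_neq0 b0'.
Qed.

Lemma local_ringM zeta f g :
  local_ring zeta f -> local_ring zeta g -> local_ring zeta (f * g).
Proof.
move=> [a [b [b0 ->]]] [a' [b' [b0' ->]]].
exists (a * a'), (b * b'); split; first by rewrite !hornerM mulf_neq0.
by rewrite (tofracM a a') (tofracM b b') mulf_div.
Qed.

Lemma local_ideal0 zeta p q : local_ideal zeta p q 0.
Proof.
exists 0, 0; rewrite -tofrac0; split; [exact: local_ring_tofrac..|].
by rewrite tofrac0 !mul0r addr0.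
Qed.

Lemma local_idealD zeta p q f g :
  local_ideal zeta p q f -> local_ideal zeta p q g -> local_ideal zeta p q (f + g).
Proof.
move=> [a [b [ra rb ->]]] [a' [b' [ra' rb' ->]]].
exists (a + a'), (b + b'); split; [exact: local_ringD..|].
by rewrite !mulrDl addrACA.
Qed.

Lemma local_idealMl zeta p q f g :
  local_ring zeta f -> local_ideal zeta p q g -> local_ideal zeta p q (f * g).
Proof.
move=> rf [a [b [ra rb ->]]].
exists (f * a), (f * b); split; [exact: local_ringM..|].
by rewrite mulrDr !mulrA.
Qed.

(** Expand each [e' j] in the [e i] modulo the ideal. If [n < m], the coefficient matrix has a
    nonzero left kernel vector, which gives a forbidden relation among the [e' j]. *)
Lemma leq_local_quotient_basis zeta p q n (e : 'I_n -> _) m (e' : 'I_m -> _) :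
  local_quotient_basis zeta p q e -> local_quotient_basis zeta p q e' ->
  (m <= n)%N.
Proof.
move=> [_ span _] [loc' _ free'].
have /choice[c cP] : forall j, exists c, local_ideal zeta p q (e' j - lin_comb c e).
  by move=> j; apply: span.
pose M := \matrix_(j < m, i < n) c j i.
rewrite leqNgt; apply/negP => nm.
have : kermx M != 0.
  by rewrite -mxrank_eq0 mxrank_ker subn_eq0 -ltnNge (leq_ltn_trans (rank_leq_col M)).
case/rowV0Pn => v /sub_kermxP vM /eqP[]; apply/rowP => j; rewrite mxE.
apply: (free' (v 0)) j.
(* The subtracted combinations of the [e i] add up to zero because [v *m M = 0]; every remaining
   summand is in the ideal. *)
have -> : lin_comb (v 0) e' = \sum_j (v 0 j)%:P%:P%:F * (e' j - lin_comb (c j) e).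
  rewrite /lin_comb; under [RHS]eq_bigr do rewrite mulrBr mulr_sumr.
  rewrite sumrB exchange_big /= [X in _ - X]big1 ?subr0// => i _.
  under eq_bigr do rewrite mulrA -tofracM -!polyCM.
  rewrite -mulr_suml -!rmorph_sum /=.
  have -> : \sum_j v 0 j * c j i = (v *m M) 0 i.
    by rewrite mxE; apply: eq_bigr => j _; rewrite mxE.
  by rewrite vM mxE !polyC0 tofrac0 mul0r.
elim/big_ind: _ => [||j _]; [exact: local_ideal0|exact: local_idealD|].
by apply: local_idealMl => //; apply: local_ring_tofrac.
Qed.

(** [A.[L]] is the restriction of [A] to the curve z_1 = L(z_2), a polynomial in z_2. *)
Lemma horner2_comp A (L : {poly C}) y : A.[L].[y] = A.[L.[y], y].
Proof.
elim/poly_ind: A => [|A k IH]; first by rewrite !horner0.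
by rewrite !(hornerD, hornerM, hornerX, hornerC) IH.
Qed.

(** * Quotient by a graph and a curve meeting it to order [n] *)

Section Graph.
Variables (L : {poly C}) (y0 : C) (u Q : {poly {poly C}}) (G : {poly C}) (n : nat).
Hypothesis (u0 : u.[L.[y0], y0] != 0) (G0 : G.[y0] != 0).
Hypothesis QL : Q.[L] = G * ('X - y0%:P) ^+ n.

Definition graph_basis (i : 'I_n) : {fraction {poly {poly C}}} :=
  (('X - y0%:P) ^+ i)%:P%:F.

Definition taylor (c : 'I_n -> C) : {poly C} :=
  \sum_i c i *: ('X - y0%:P) ^+ i.

Lemma lin_comb_graph_basis c : lin_comb c graph_basis = (taylor c)%:P%:F.
Proof.
rewrite /lin_comb /taylor !rmorph_sum; apply: eq_bigr => i _ /=.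
by rewrite -mul_polyC -tofracM -polyCM.
Qed.

Lemma size_taylor c : (size (taylor c) <= n)%N.
Proof.
rewrite (leq_trans (size_sum _ _ _)) //; apply/bigmax_leqP => i _.
by rewrite (leq_trans (size_scale_leq _ _)) // size_exp_XsubC.
Qed.

Lemma taylor_shift c : taylor c \Po ('X + y0%:P) = \sum_i c i *: 'X^i.
Proof.
rewrite rmorph_sum; apply: eq_bigr => i _ /=.
by rewrite comp_polyZ rmorphXn /= comp_polyB comp_polyX comp_polyC addrK.
Qed.

Lemma taylor_eq0 c : taylor c = 0 -> forall i, c i = 0.
Proof.
move=> c0 i; have := taylor_shift c; rewrite c0 comp_poly0.
move=> /(congr1 (fun r : {poly C} => r`_i)); rewrite coef0 coef_sum (bigD1 i) //=.
rewrite coefZ coefXn eqxx mulr1 big1 ?addr0 // => j ji.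
by rewrite coefZ coefXn eq_sym val_eqE (negPf ji) mulr0.
Qed.

Lemma taylor_exists (r : {poly C}) : (size r <= n)%N -> exists c, r = taylor c.
Proof.
move=> sr; pose s := r \Po ('X + y0%:P); exists (fun i => s`_i).
have -> : r = s \Po ('X - y0%:P).
  by rewrite -comp_polyA comp_polyD comp_polyX comp_polyC subrK comp_polyXr.
have ss : (size s <= n)%N by rewrite size_comp_poly2 // size_XaddC.
rewrite comp_polyE (big_ord_widen _ (fun i => s`_i *: ('X - y0%:P) ^+ i) ss).
rewrite big_mkcond; apply: eq_bigr => i _.
by case: ltnP => // /(nth_default _) ->; rewrite scale0r.
Qed.

(* (Y - y0)^n in the quotient ring becomes Q/G, hence vanishes. *)
Lemma graph_ideal A B : B.[L.[y0], y0] != 0 -> ('X - y0%:P) ^+ n %| A.[L] ->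
  local_ideal (L.[y0], y0) (u * ('X - L%:P)) Q (A%:F / B%:F).
Proof.
move=> B0 /dvdpP[T AT].
(* On the graph, [A * G] and [T * Q] agree, so their difference is divisible by z_1 - L(z_2). *)
have /factor_theorem[S AS] : root (A * G%:P - T%:P * Q) L.
  by rewrite rootE !hornerE AT QL; apply/eqP; ring.
have B0' := @tofrac_neq0 (L.[y0], y0) _ B0.
have u0' := @tofrac_neq0 (L.[y0], y0) _ u0.
have G2 : (G%:P).[L.[y0], y0] != 0 by rewrite hornerC.
have G0' := @tofrac_neq0 (L.[y0], y0) _ G2.
exists (S%:F / (u * B * G%:P)%:F), ((T%:P)%:F / (B * G%:P)%:F); split.
- by exists S, (u * B * G%:P); rewrite !hornerM !mulf_neq0.
- by exists T%:P, (B * G%:P); rewrite !hornerM !mulf_neq0.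
have e : A%:F * (G%:P)%:F = S%:F * ('X - L%:P)%:F + (T%:P)%:F * Q%:F.
  by rewrite -!tofracM -tofracD -AS; congr _%:F; ring.
rewrite (tofracM (u * B)) (tofracM u B) (tofracM u ('X - _)) (tofracM B).
exact: (fraction_combination B0' G0' u0' e).
Qed.

(** Restriction to the graph identifies the quotient with polynomials in z_2 modulo
    [('X - y0%:P) ^+ n]. Denominators nonzero at the point become invertible there, which gives
    spanning; freeness holds because a nonzero polynomial of size at most [n] is not divisible by
    that power. *)
Lemma graph_quotient_basis :
  local_quotient_basis (L.[y0], y0) (u * ('X - L%:P)) Q graph_basis.
Proof.
have cop (B : {poly {poly C}}) : B.[L.[y0], y0] != 0 ->
    coprimep B.[L] (('X - y0%:P) ^+ n).
  by rewrite -horner2_comp => B0; rewrite coprimep_expr // coprimep_XsubC.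
split=> [i|f [A [B [B0 ->]]]|c [f1 [f2 [[A1 [B1 [B10 ->]]] [A2 [B2 [B20 ->]]]]]]].
- exact: local_ring_tofrac.
- have [[U V] /= UV] := Bezout_eq1_coprimepP _ _ (cop _ B0).
  (* [U] inverts [B.[L]] modulo the power, so [r] represents [A / B] on the graph. *)
  pose r := (A.[L] * U) %% ('X - y0%:P) ^+ n.
  have [|c rE] := taylor_exists (r := r).
    by rewrite -ltnS -(size_exp_XsubC n y0) ltn_modp expf_neq0 // polyXsubC_eq0.
  exists c; rewrite lin_comb_graph_basis -rE.
  have -> : A%:F / B%:F - r%:P%:F = (A - B * r%:P)%:F / B%:F.
    by rewrite tofracB (mulrC B) (tofracM _ B) mulrBl mulfK //
       (@tofrac_neq0 (L.[y0], y0)).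
  apply: graph_ideal => //; rewrite !hornerE.
  set W := ('X - y0%:P) ^+ n in UV r rE *.
  have rq : r = A.[L] * U - (A.[L] * U) %/ W * W.
    by apply/eqP; rewrite eq_sym subr_eq addrC -divp_eq.
  have -> : A.[L] - B.[L] * r = (A.[L] * V + B.[L] * ((A.[L] * U) %/ W)) * W.
    rewrite rq -[X in X - _]mulr1 -UV; ring.
  exact: dvdp_mulIr.
- rewrite lin_comb_graph_basis => e; apply: taylor_eq0.
  set r := taylor c in e *; set W := ('X - y0%:P) ^+ n in cop *.
  have B1' := tofrac_neq0 (B10 : B1.[(L.[y0], y0).1, (L.[y0], y0).2] != 0).
  have B2' := tofrac_neq0 (B20 : B2.[(L.[y0], y0).1, (L.[y0], y0).2] != 0).
  have e' : r%:P * (B1 * B2) = A1 * B2 * (u * ('X - L%:P)) + A2 * B1 * Q.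
    apply/eqP; rewrite -tofrac_eq tofracD; apply/eqP.
    rewrite (tofracM _ (B1 * B2)) (tofracM B1) (tofracM (A1 * B2)) (tofracM A1).
    rewrite (tofracM (A2 * B1)) (tofracM A2).
    exact: (fraction_clear B1' B2' e).
  have rW : W %| r * (B1.[L] * B2.[L]).
    (* Restriction to the graph kills the multiple of z_1 - L(z_2) and leaves a multiple of [W]. *)
    have := congr1 (horner^~ L) e'.
    rewrite /= !(hornerM, hornerXsubC, hornerD, hornerC) => ->.
    by rewrite subrr !mulr0 add0r QL -/W mulrA dvdp_mulIr.
  have {}rW : W %| r.
    by move: rW; rewrite Gauss_dvdpl // coprimep_sym coprimepMl !cop.
  apply: contraTeq rW => r0; apply/negP => /(dvdp_leq r0).
  by rewrite leqNgt /W size_exp_XsubC ltnS size_taylor.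
Qed.

End Graph.
End LocalRing.

(** * Multiplicities on the torus for linear polynomials *)

Section Saturation.
Variable R : realType.
Local Notation C := R[i].
Implicit Types (p q : {poly {poly C}}) (zeta : C * C).
Local Notation "x %:F" := (@FracField.tofrac _ x).

Lemma intersection_multiplicityE p q zeta n (e : 'I_n -> _) :
  local_quotient_basis zeta p q e ->
  intersection_multiplicity p q zeta = n%:R%:E.
Proof.
move=> be; apply: xget_unique; first by exists n, e.
move=> _ [m [e' [be' ->]]]; congr _%:R%:E; apply/eqP.
by rewrite eqn_leq (leq_local_quotient_basis be be') (leq_local_quotient_basis be' be).
Qed.

(** Here [p] is a unit of the local ring, so the quotient is zero and the empty family is a
    basis. *)
Lemma intersection_multiplicity_eq0 p q zeta : p.[zeta.1, zeta.2] != 0 ->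
  intersection_multiplicity p q zeta = 0%E.
Proof.
move=> p0.
suff : local_quotient_basis zeta p q (fun _ : 'I_0 => 0).
  exact: intersection_multiplicityE.
split=> [[]//|f rf|c _ []//]; exists (fun _ => 0).
rewrite /lin_comb big_ord0 subr0; exists (f / p%:F), 0.
split; last by rewrite mul0r addr0 mulfVK // (tofrac_neq0 p0).
- by apply: local_ringM => //; exists 1, p; rewrite tofrac1 mul1r.
- by rewrite -tofrac0; apply: local_ring_tofrac.
Qed.

Section Linear.
Variables (p : {poly {poly C}}).
Hypothesis hp : has_bidegree p 1 1.
Let a := p`_0`_0. Let b := p`_1`_0. Let c := p`_0`_1.
Hypotheses (d0 : p`_1`_1 = 0) (b0 : b != 0) (c0 : c != 0).
Hypothesis abc : `|a| = `|b| + `|c|.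

Definition zero_line : {poly C} := (- b^-1)%:P * (a%:P + c%:P * 'X).
(** The point [y] with [c * y = - a * |c| / |a|]. Then [a + c * y = a * |b| / |a|], so the
    corresponding z_1 also has modulus 1. *)
Definition boundary_zero : C := - (`|a| * `|c|) / (a^* * c).

Let a0 : a != 0.
Proof. by rewrite -normr_gt0 abc addr_gt0 ?normr_gt0. Qed.

Let na2 : a * a^* = (`|b| + `|c|) ^+ 2. Proof. by rewrite -normCK abc. Qed.

Lemma linear_zero_lineE : p = b%:P%:P * ('X - zero_line%:P).
Proof.
rewrite {1}(bidegree11E hp) -/a -/b -/c d0 /bilin /zero_line scale0r -mul_polyC.
rewrite mulrBr -polyCM mulrA -polyCM mulrN mulfV // polyCN polyC1 addr0 mulN1r polyCN.
ring.
Qed.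

(** Up to the factor [- b^-1], the restriction is the quadratic with coefficients [a c^*],
    [|a|^2 + |c|^2 - |b|^2] and [a^* c]. As [|b| = |a| - |c|], the middle one is [2 |a| |c|], and
    the discriminant vanishes. *)
Lemma reflection_zero_line : (reflection p).[zero_line] =
  (- (a^* * c / b))%:P * ('X - boundary_zero%:P) ^+ 2.
Proof.
rewrite (reflection_bidegree11 hp) -/a -/b -/c d0 conjC0 /bilin /zero_line.
rewrite !(hornerD, hornerM, hornerX, hornerC).
rewrite -!mul_polyC.
have ac0 : a^* * c != 0 by rewrite mulf_neq0 ?conjC_eq0.
have e0 : a^* * c * boundary_zero ^+ 2 = a * c^*.
  have : `|a| ^+ 2 * `|c| ^+ 2 = a * a^* * (c * c^*) by rewrite !normCK.
  rewrite /boundary_zero => e.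
  have -> : a^* * c * (- (`|a| * `|c|) / (a^* * c)) ^+ 2 =
      (`|a| ^+ 2 * `|c| ^+ 2) / (a^* * c).
    by field; rewrite c0 conjC_eq0.
  by rewrite e; field; rewrite c0 conjC_eq0.
have e1 : - 2 * (a^* * c * boundary_zero) = c * c^* + a * a^* - b * b^*.
  rewrite na2 -!normCK /boundary_zero (mulrC (a^* * c)) mulfVK // abc; ring.
transitivity ((- b^-1 * (a * c^*))%:P +
   (- b^-1 * (c * c^* + a * a^* - b * b^*))%:P * 'X +
   (- b^-1 * (a^* * c))%:P * 'X ^+ 2).
  have -> : - b^-1 * (c * c^* + a * a^* - b * b^*) = - b^-1 * (c * c^* + a * a^*) + b^*.
    by field.
  rewrite !(polyCD, polyCM). ring.
by rewrite -e0 -e1 !(polyCN, polyCD, polyCM, expr2); ring.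
Qed.

Lemma boundary_zero_torus : torus2 (zero_line.[boundary_zero], boundary_zero).
Proof.
have nb : `|b| != 0 by rewrite normr_eq0.
have na : `|b| + `|c| != 0 by rewrite -abc normr_eq0.
have nc : `|c| != 0 by rewrite normr_eq0.
split => /=; last first.
  rewrite /boundary_zero normrM normfV normrN !normrM !normr_id norm_conjC.
  by rewrite mulfV // mulf_neq0 // abc.
rewrite /zero_line !(hornerM, hornerD, hornerX, hornerC).
have -> : a + c * boundary_zero = a * (`|b| / (`|b| + `|c|)).
  rewrite /boundary_zero abc; apply: (@mulIf _ a^*); first by rewrite conjC_eq0.
  rewrite [RHS]mulrAC na2 mulrDl na2.
  have -> : c * (- ((`|b| + `|c|) * `|c|) / (a^* * c)) * a^* =
      - ((`|b| + `|c|) * `|c|).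
    by field; rewrite c0 conjC_eq0 a0.
  by move: na; set x := `|b|; set y := `|c| => ?; field.
rewrite -abc !(normrM, normrN, normfV) !normr_id [X in _ * X]mulrC divfK ?mulVf //.
by rewrite abc.
Qed.

(** On the torus 1 / conj z = z, so a zero of [p] is also a zero of the reflection; its second
    coordinate is then the double root. *)
Lemma torus2_zero (z : C * C) : torus2 z -> p.[z.1, z.2] = 0 ->
  z = (zero_line.[boundary_zero], boundary_zero).
Proof.
case: z => x y [/= nx ny] pxy.
have inv_conj (w : C) : `|w| = 1 -> w != 0 /\ (w^*)^-1 = w.
  move=> nw; have w0 : w != 0 by rewrite -normr_eq0 nw oner_eq0.
  split=> //; apply: (mulIf (_ : w^* != 0)); first by rewrite conjC_eq0.
  by rewrite -normCK nw expr1n mulVf // conjC_eq0.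
have [x0 ex] := inv_conj x nx; have [y0 ey] := inv_conj y ny.
have qxy : (reflection p).[x, y] = 0.
  by rewrite horner_reflection // ex ey pxy conjC0 mulr0.
have xE : x = zero_line.[y].
  move: pxy; rewrite {1}linear_zero_lineE 
    !(hornerM, hornerXsubC, hornerD, hornerN, hornerC) => /eqP.
  by rewrite mulf_eq0 (negPf b0) /= subr_eq0 => /eqP.
have yE : y = boundary_zero.
  move: qxy; rewrite xE -horner2_comp reflection_zero_line.
  rewrite !(hornerM, horner_exp, hornerXsubC, hornerC) => /eqP.
  rewrite !mulf_eq0 oppr_eq0 subr_eq0 !mulf_eq0 invr_eq0 conjC_eq0.
  by rewrite (negPf a0) (negPf b0) (negPf c0) /= orbb => /eqP.
by rewrite xE yE.
Qed.

Lemma linear_T2_saturated : T2_saturated p.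
Proof.
case: (hp) => p0 dX dY; rewrite /T2_saturated dX dY.
set zeta := (zero_line.[boundary_zero], boundary_zero).
(* [graph_quotient_basis] applies with [L] the zero line, [u] the constant [b] and exponent 2, the
   order of the double root. *)
have mz : intersection_multiplicity p (reflection p) zeta = 2%:R%:E.
  have kappa0 : (- (a^* * c / b))%:P.[boundary_zero] != 0.
    by rewrite hornerC oppr_eq0 !mulf_neq0 ?invr_eq0 ?conjC_eq0.
  rewrite {1}linear_zero_lineE; apply/intersection_multiplicityE.
  apply: graph_quotient_basis kappa0 reflection_zero_line.
  by rewrite !hornerC.
have m0 z : torus2 z -> z <> zeta -> intersection_multiplicity p (reflection p) z = 0%E.
  move=> Tz zz; apply: intersection_multiplicity_eq0; apply/eqP => pz.
  exact/zz/torus2_zero.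
have mge0 z : torus2 z -> (0 <= intersection_multiplicity p (reflection p) z)%E.
  by move=> Tz; have [->|/eqP zz] := eqVneq z zeta; rewrite ?mz ?lee_fin // m0.
rewrite (esumID [set zeta]) // setIidr; last by move=> _ ->; exact: boundary_zero_torus.
rewrite esum_set1 ?mz ?lee_fin // esum1 ?adde0 // => z [Tz zz].
exact: m0.
Qed.

End Linear.
End Saturation.

(** * Perturbations in PRP_2 *)

Section Bound.
Variable C : numClosedFieldType.
Implicit Types (a b c x y z w : C).

Lemma addCJ_ge_norm z : 0 <= z + z^* + 2 * `|z|.
Proof.
have := (leif_Re_Creal (- z)).1; rewrite raddfN /= normrN -subr_ge0 opprK ReE => h.
have -> : z + z^* + 2 * `|z| = 2 * (`|z| + (z + z^*) / 2) by field.
by rewrite mulr_ge0.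
Qed.

(* Lower bound for |p|^2 - |p~|^2 in terms of B = |b|, G = |c|, B + G + D = |a|,
   r = |z_1| and s = |z_2|; it is a sum of nonnegative terms. *)
Lemma schur_gap_gt0 (B G D r s : C) : 0 <= B -> 0 <= G -> 0 <= D ->
  0 < B + G + D -> 0 <= r < 1 -> 0 <= s < 1 ->
  0 < (B + G + D) ^+ 2 * (1 - r ^+ 2 * s ^+ 2)
      + (B ^+ 2 - G ^+ 2) * (r ^+ 2 - s ^+ 2)
      - 2 * ((B + G + D) * G * s) * (1 - r ^+ 2)
      - 2 * ((B + G + D) * B * r) * (1 - s ^+ 2).
Proof.
move=> B0 G0 D0 A0 /andP[r0 r1] /andP[s0 s1].
have hr : 0 < 1 - r by rewrite subr_gt0.
have hs : 0 < 1 - s by rewrite subr_gt0.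
have hr2 : 0 < 1 - r ^+ 2 by rewrite subr_gt0 expr_lt1.
have hs2 : 0 < 1 - s ^+ 2 by rewrite subr_gt0 expr_lt1.
have hrs : 0 < 1 - r ^+ 2 * s ^+ 2.
  by rewrite -exprMn subr_gt0 expr_lt1 ?mulr_ge0 ?mulr_ilt1.
pose m1 := (1 - s ^+ 2) * (1 - r) ^+ 2; pose m2 := (1 - r ^+ 2) * (1 - s) ^+ 2.
have m10 : 0 < m1 by rewrite mulr_gt0 ?exprn_gt0.
have m20 : 0 < m2 by rewrite mulr_gt0 ?exprn_gt0.
pose k := 2 * (G * ((1 - s) * (1 + r ^+ 2 * s)) + B * ((1 - r) * (1 + s ^+ 2 * r))).
have k0 : 0 <= k.
  have p1 u v : 0 <= u -> 0 <= v -> 0 <= 1 + u ^+ 2 * v :> C.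
    by move=> u0 v0; rewrite addr_ge0 // mulr_ge0 ?exprn_ge0.
  apply: mulr_ge0 => //; apply: addr_ge0; rewrite mulr_ge0 // mulr_ge0 ?p1 //.
    exact: ltW hs.
  exact: ltW hr.
(* Expansion in powers of [D]. Strict positivity comes from the first term if [D = 0], and from the
   [D ^+ 2] term otherwise. *)
rewrite (_ : _ - _ = (B + G) * (B * m1 + G * m2) +
   (D ^+ 2 * (1 - r ^+ 2 * s ^+ 2) + D * k)); last by rewrite /k /m1 /m2; ring.
have [D00|Dn0] := eqVneq D 0.
  rewrite D00 expr0n /= !mul0r !addr0 mulr_gt0 //; first by rewrite D00 addr0 in A0.
  have [B00|Bn0] := eqVneq B 0.
    by rewrite B00 mul0r add0r mulr_gt0 //; rewrite B00 D00 add0r addr0 in A0.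
  have Bp : 0 < B by rewrite lt0r Bn0.
  apply: ltr_wpDr; first exact: mulr_ge0 G0 (ltW m20).
  exact: mulr_gt0.
have Dp : 0 < D by rewrite lt0r Dn0.
apply: ltr_wpDl.
  by rewrite mulr_ge0 // addr_ge0 // mulr_ge0 // ltW.
by apply: ltr_wpDr; [rewrite mulr_ge0|rewrite mulr_gt0 // exprn_gt0].
Qed.

(** In the difference of squared moduli the cross terms between [b] and [c] cancel. Bounding the
    real parts of [a^* c y] and [a^* b x] below by minus their moduli leaves [schur_gap_gt0] with
    [D = |a| - |b| - |c|]. *)
Lemma reflection_lt a b c x y : a != 0 -> `|b| + `|c| <= `|a| ->
  `|x| < 1 -> `|y| < 1 ->
  `|(bilin 0 c^* b^* a^*).[x, y]| < `|(bilin a b c 0).[x, y]|.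
Proof.
move=> a0 abc x1 y1; rewrite !bilinE.
rewrite -(@ltr_pXn2r _ 2) ?nnegrE // -subr_gt0.
set gap := (_ - _).
have gapE : gap = `|a| ^+ 2 * (1 - `|x| ^+ 2 * `|y| ^+ 2)
      + (`|b| ^+ 2 - `|c| ^+ 2) * (`|x| ^+ 2 - `|y| ^+ 2)
      + (a^* * c * y + (a^* * c * y)^*) * (1 - `|x| ^+ 2)
      + (a^* * b * x + (a^* * b * x)^*) * (1 - `|y| ^+ 2).
  rewrite /gap !normCK !(rmorphD, rmorphM) /= !conjCK conjC0; ring.
have hx : 0 < 1 - `|x| ^+ 2 by rewrite subr_gt0 expr_lt1.
have hy : 0 < 1 - `|y| ^+ 2 by rewrite subr_gt0 expr_lt1.
have := @schur_gap_gt0 `|b| `|c| (`|a| - `|b| - `|c|) `|x| `|y|.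
rewrite (_ : `|b| + `|c| + _ = `|a|); last by ring.
rewrite !normr_ge0 x1 y1 normr_gt0 -addrA -opprD subr_ge0.
move=> /(_ isT isT abc a0 isT isT).
move=> E; apply: (lt_le_trans E); rewrite gapE -subr_ge0.
have -> : forall u v w1 w2 t1 t2 h1 h2 : C,
   u + v + w1 * h1 + w2 * h2 - (u + v - t1 * h1 - t2 * h2) =
   (w1 + t1) * h1 + (w2 + t2) * h2 by move=> *; ring.
rewrite addr_ge0 // mulr_ge0 ?(ltW hx) ?(ltW hy) //.
- by have := addCJ_ge_norm (a^* * c * y); rewrite !normrM norm_conjC.
- by have := addCJ_ge_norm (a^* * b * x); rewrite !normrM norm_conjC.
Qed.

End Bound.

(** * Membership and midpoints for the functions (p + p~) / (p - p~) *)

Section Herglotz.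
Variable R : realType.
Local Notation C := R[i].
Implicit Types (a b c al : C) (z : C * C).

(** The real part equals [(|u|^2 - |v|^2) / |u - v|^2]. *)
Lemma Re_cayley_gt0 (u v : C) : `|v| < `|u| -> 0 < complex.Re ((u + v) / (u - v)).
Proof.
move=> vu; have uv0 : u - v != 0.
  by rewrite subr_eq0; apply: contraTneq vu => ->; rewrite ltxx.
rewrite -ltcR complexRe ReE.
have -> : (u + v) / (u - v) + ((u + v) / (u - v))^* =
    2 * (`|u| ^+ 2 - `|v| ^+ 2) / `|u - v| ^+ 2.
  rewrite !normCK !(rmorphM, rmorphD, rmorphN, fmorphV) /=.
  by field; rewrite -rmorphB conjC_eq0 uv0.
have h : 0 < `|u| ^+ 2 - `|v| ^+ 2 by rewrite subr_gt0 ltr_pXn2r ?nnegrE.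
by rewrite !divr_gt0 ?mulr_gt0 ?exprn_gt0 ?normr_gt0.
Qed.

Lemma horner2D (p q : {poly {poly C}}) x y :
  (p + q).[x, y] = p.[x, y] + q.[x, y].
Proof. by rewrite 2!hornerD. Qed.

Lemma horner2B (p q : {poly {poly C}}) x y :
  (p - q).[x, y] = p.[x, y] - q.[x, y].
Proof. by rewrite 2!hornerD 2!hornerN. Qed.

Lemma bilin_holomorphic a b c d (D : set (C * C)) :
  holomorphic_on D (fun z => (bilin a b c d).[z.1, z.2]).
Proof.
move=> z _.
have -> : (fun w : C * C => (bilin a b c d).[w.1, w.2]) =
    (fun w : C^o * C^o => (a + b * w.1 + c * w.2 + d * w.1 * w.2 : C^o)).
  by apply/funext => w; rewrite bilinE.
have d1 : differentiable (fun w : C^o * C^o => w.1 : C^o) z.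
  by apply: (linear_differentiable (f := fst)) => w; exact: cvg_fst.
have d2 : differentiable (fun w : C^o * C^o => w.2 : C^o) z.
  by apply: (linear_differentiable (f := snd)) => w; exact: cvg_snd.
have dc (k : C) : differentiable (fun w : C^o * C^o => (k : C^o)) z.
  exact: differentiable_cst.
have dm := differentiableM.
apply: differentiableD; last exact: (dm _ _ _ _ _ (dm _ _ _ _ _ (dc d) d1) d2).
apply: differentiableD; last exact: (dm _ _ _ _ _ (dc c) d2).
apply: differentiableD; last exact: (dm _ _ _ _ _ (dc b) d1).
exact: dc.
Qed.

Definition herglotz_num a b c z : C :=
  a + (b + c^*) * z.1 + (c + b^*) * z.2 + a^* * z.1 * z.2.

Definition herglotz_den a b c z : C :=
  a + (b - c^*) * z.1 + (c - b^*) * z.2 - a^* * z.1 * z.2.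

Lemma herglotz_numE a b c z :
  herglotz_num a b c z = (bilin a b c 0 + bilin 0 c^* b^* a^*).[z.1, z.2].
Proof. by rewrite bilinD bilinE addr0 add0r. Qed.

Lemma herglotz_denE a b c z :
  herglotz_den a b c z = (bilin a b c 0 - bilin 0 c^* b^* a^*).[z.1, z.2].
Proof. by rewrite bilinN bilinD bilinE oppr0 addr0 add0r !mulNr. Qed.

Definition herglotz a b c z : C := herglotz_num a b c z / herglotz_den a b c z.

Section Membership.
Variables a b c : C.
Hypotheses (a0 : a != 0) (abc : `|b| + `|c| <= `|a|).

Lemma herglotz_den_neq0 z : bidisk z -> herglotz_den a b c z != 0.
Proof.
move=> [z1 z2]; have := reflection_lt a0 abc z1 z2.
rewrite herglotz_denE horner2B subr_eq0 => h.
by apply: contraTneq h => ->; rewrite ltxx.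
Qed.

Lemma herglotz_PRP2 : PRP2 (herglotz a b c).
Proof.
split=> [z Dz|z [z1 z2]|].
- have dV : differentiable (fun w : C^o * C^o => (herglotz_den a b c w)^-1 : C^o) z.
    apply: differentiableV; last exact: herglotz_den_neq0.
    have -> : (herglotz_den a b c : C^o * C^o -> C^o) = _ :=
      funext (herglotz_denE a b c).
    by rewrite bilinN bilinD; apply: bilin_holomorphic Dz.
  have dN : differentiable (herglotz_num a b c : C^o * C^o -> C^o) z.
    have -> : (herglotz_num a b c : C^o * C^o -> C^o) = _ :=
      funext (herglotz_numE a b c).
    by rewrite bilinD; apply: bilin_holomorphic Dz.
  exact: (differentiableM dN dV).
- rewrite /herglotz herglotz_numE herglotz_denE horner2D horner2B.
  by apply: Re_cayley_gt0; apply: reflection_lt.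
- rewrite /herglotz /herglotz_num /herglotz_den /= !mulr0 !(addr0, oppr0).
  exact: mulfV.
Qed.

End Membership.

(* Adding al z_1 + conj al z_2 to both p and p~ leaves p - p~ unchanged. *)
Lemma herglotz_perturb a b c al z : herglotz a (b + al) (c + al^*) z =
  herglotz a b c z + 2 * (al * z.1 + al^* * z.2) / herglotz_den a b c z.
Proof.
have -> : herglotz a (b + al) (c + al^*) z =
    herglotz_num a (b + al) (c + al^*) z / herglotz_den a b c z.
  rewrite /herglotz; congr (_ / _).
  by rewrite /herglotz_den !rmorphD /= conjCK; ring.
rewrite -mulrDl; congr (_ / _).
by rewrite /herglotz_num !rmorphD /= conjCK; ring.
Qed.

(** The functions for [al] and [- al] have the given one as midpoint. Extremality makes them
    coincide, so the correction term in [herglotz_perturb] vanishes on the bidisk. *)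
Lemma herglotz_extreme a b c al : a != 0 -> `|b| + `|c| <= `|a| ->
  extreme_point_on (@bidisk C) (@PRP2 R) (herglotz a b c) ->
  `|b + al| + `|c + al^*| <= `|a| -> `|b - al| + `|c - al^*| <= `|a| -> al = 0.
Proof.
move=> a0 abc [_ ext] hp hm.
have half : 0 < (2^-1 : R) < 1 by rewrite invr_gt0 ltr0n invf_lt1 ?ltr0n ?ltr1n.
have halfC : ((2^-1 : R)%:C)%C = 2^-1 :> C by rewrite fmorphV rmorph_nat.
have mean z : bidisk z -> herglotz a b c z =
    ((2^-1 : R)%:C)%C * herglotz a (b + al) (c + al^*) z
    + ((1 - 2^-1 : R)%:C)%C * herglotz a (b - al) (c - al^*) z.
  move=> Dz; have -> : 1 - 2^-1 = 2^-1 :> R by field.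
  rewrite halfC -[- al^*]rmorphN !herglotz_perturb rmorphN /=; field.
  exact: herglotz_den_neq0 Dz.
(* At this point the numerator of the correction, [2 * (al * z.1 + al^* * z.2)], is [al] itself. *)
have D2 : bidisk (2^-1 : C, 0 : C).
  split=> /=; first by rewrite normfV normr_nat invf_lt1 ?ltr0n ?ltr1n.
  by rewrite normr0 ltr01.
have [] := ext _ _ _ (herglotz_PRP2 a0 hp) (herglotz_PRP2 a0 hm) half mean _ D2.
rewrite herglotz_perturb => /eqP; rewrite -subr_eq0 addrAC subrr add0r.
rewrite mulf_eq0 invr_eq0 (negPf (herglotz_den_neq0 a0 abc D2)) orbF /= mulr0 addr0.
by rewrite mulrCA mulfV ?mulr1 ?pnatr_eq0 // => /eqP.
Qed.

End Herglotz.

(** * Coefficient constraints from bidegree and stability *)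

Section Stable.
Variable C : numClosedFieldType.
Implicit Types (p : {poly {poly C}}) (a b c : C).

Lemma bidegree11_linear_neq0 p : has_bidegree p 1 1 -> p`_1`_1 = 0 ->
  p`_1`_0 != 0 /\ p`_0`_1 != 0.
Proof.
move=> hp d0; case: (hp) => _; rewrite /deg1 /deg2 => dX dY.
have /leq_sizeP sX : (size p <= 2)%N by case: (size p) dX => // n <-.
have [p0E p1E] := coef_bilin p`_0`_0 p`_1`_0 p`_0`_1 p`_1`_1.
rewrite -(bidegree11E hp) d0 in p0E p1E.
split; apply/eqP => e0.
  suff : (size p <= 1)%N by case: (size p) dX => // -[].
  apply/leq_sizeP => -[|[|j]] // _; last exact: sX.
  by rewrite p1E e0 scale0r addr0.
suff : (sizeY p <= 1)%N by case: (sizeY p) dY => // -[].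
apply/bigmax_leqP => -[i _] _ /=; case: i => [|[|i]].
- by rewrite p0E e0 scale0r addr0 size_polyC_leq1.
- by rewrite p1E scale0r addr0 size_polyC_leq1.
- by rewrite sX // size_poly0.
Qed.

(** If [|a| < |b| + |c|], a zero in the bidisk is found by splitting [- a] between [b * z_1] and
    [c * z_2] in proportion to [|b|] and [|c|]. *)
Lemma linear_stable_norm_le a b c : b != 0 -> c != 0 ->
  (forall z, bidisk z -> (bilin a b c 0).[z.1, z.2] != 0) ->
  `|b| + `|c| <= `|a|.
Proof.
move=> b0 c0 stable; rewrite real_leNgt ?realD ?normr_real //.
apply/negP => lt_a; have s0 : 0 < `|b| + `|c| by apply: le_lt_trans lt_a.
pose w d := - (a / (`|b| + `|c|)) * (`|d| / d).
have nw d : d != 0 -> `|w d| < 1.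
  move=> d0; rewrite /w normrM normrN !normf_div !normr_id divff ?normr_eq0 //.
  by rewrite mulr1 (gtr0_norm s0) ltr_pdivrMr ?mul1r.
have := stable (w b, w c) (conj (nw b b0) (nw c c0)).
rewrite bilinE /w /= !mul0r addr0 => /eqP; apply.
by field; rewrite b0 c0 gt_eqF.
Qed.

End Stable.

Theorem theorem1p8 (R : realType) (p : {poly {poly R[i]}})
  (hdeg : has_bidegree p 1 1)
  (hstable : scattering_stable p)
  (h0 : (reflection p).[0, 0] = 0)
  (hext : extreme_point_on (@bidisk R[i]) (@PRP2 R)
     (fun z : R[i] * R[i] =>
        (p + reflection p).[z.1, z.2] / (p - reflection p).[z.1, z.2])) :
  T2_saturated p /\ irreducible2 (p - reflection p).
Proof.
have pE := bidegree11E hdeg; have qE := reflection_bidegree11 hdeg.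
have d0 : p`_1`_1 = 0.
  by move: h0; rewrite qE bilinE !(mulr0, addr0) => /eqP; rewrite conjC_eq0 => /eqP.
have [b0 c0] := bidegree11_linear_neq0 hdeg d0.
rewrite d0 in pE; rewrite d0 conjC0 in qE.
set a := p`_0`_0 in pE qE; set b := p`_1`_0 in pE qE b0; set c := p`_0`_1 in pE qE c0.
have abc : `|b| + `|c| <= `|a|.
  by apply: linear_stable_norm_le => //; rewrite -pE; case: hstable.
have a0 : a != 0.
  by rewrite -normr_gt0 (lt_le_trans _ abc) // addr_gt0 ?normr_gt0.
have {}hext : extreme_point_on (@bidisk R[i]) (@PRP2 R) (herglotz a b c).
  move: hext; congr extreme_point_on; apply/funext => z.
  by rewrite /herglotz herglotz_numE herglotz_denE -pE -qE.
have rigid al := herglotz_extreme (al := al) a0 abc hext.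
have abc_eq : `|a| = `|b| + `|c|.
  apply/eqP; rewrite -subr_eq0; apply/eqP.
  (* Half the slack: moving [b] and [c] by [e] in either direction costs at most [2 * e] in total,
     so rigidity gives [e = 0]. *)
  pose e := (`|a| - (`|b| + `|c|)) / 2.
  have e0 : 0 <= e by rewrite divr_ge0 // subr_ge0.
  have eE : `|a| = `|b| + e + (`|c| + e) by rewrite /e; field.
  have ec : e^* = e by apply: conj_Creal; rewrite ger0_real.
  have : e = 0.
    apply: rigid; rewrite ec eE lerD //
      (le_trans (ler_normD _ _)) ?normrN ?(ger0_norm e0) //.
  by rewrite /e => /eqP; rewrite mulf_eq0 invr_eq0 pnatr_eq0 orbF => /eqP.
split; first exact: linear_T2_saturated.
rewrite qE pE bilinN bilinD; apply: bilin_irreducible.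
rewrite oppr0 addr0 add0r; apply/eqP => det0.
have cb : c - b^* = - (b - c^*)^* by rewrite rmorphB /= conjCK opprB.
(* The vanishing determinant says [|b - c^*| = |a|], which is equality in the triangle inequality
   for [b] and [- c^*]; hence both are nonnegative multiples of one unimodular [t]. *)
have /normCDeq[t /eqP nt [bt ct]] : `|b - c^*| = `|b| + `|- c^*|.
  rewrite normrN norm_conjC -abc_eq; apply/eqP.
  rewrite -(@eqrXn2 _ 2) // !normCK eq_sym; apply/eqP/oppr_inj.
  by rewrite -!mulrN det0 cb.
rewrite normrN norm_conjC in ct.
have nb : 0 < `|b| by rewrite normr_gt0.
have nc : 0 < `|c| by rewrite normr_gt0.
(* A positive number below both [|b|] and [|c|]. *)
pose e := `|b| * `|c| / (`|b| + `|c|).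
have e0 : 0 < e by rewrite divr_gt0 ?mulr_gt0 ?addr_gt0.
have eb : 0 <= `|b| - e.
  rewrite subr_ge0 ler_pdivrMr ?addr_gt0 // ler_pM2l // lerDr; exact: ltW.
have ec : 0 <= `|c| - e.
  rewrite subr_ge0 ler_pdivrMr ?addr_gt0 // mulrC ler_pM2l // lerDl; exact: ltW.
have cE : c = - (`|c| * t)^* by rewrite -ct rmorphN /= conjCK opprK.
have normt (k : R[i]) : 0 <= k -> `|k * t| = k.
  by move=> k0; rewrite normrM nt mulr1 ger0_norm.
suff : e * t = 0.
  by move/eqP; rewrite mulf_eq0 (gt_eqF e0) /= -normr_eq0 nt oner_eq0.
(* The shift by [s * t] changes the moduli to [|b| + s] and [|c| - s], so their sum stays [|a|]. *)
have nE (s : R[i]) : 0 <= `|b| + s -> 0 <= `|c| - s ->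
    `|b + s * t| + `|c + (s * t)^*| <= `|a|.
  move=> bs cs; rewrite {1}bt -mulrDl normt //.
  rewrite {1}cE -rmorphN -rmorphD norm_conjC /= (addrC (- _)) -opprB normrN -mulrBl.
  rewrite normt // abc_eq.
  by rewrite addrACA subrr addr0.
apply: rigid; first by apply: nE => //; rewrite addr_ge0 // ltW.
have := nE (- e); rewrite mulNr rmorphN opprK; apply=> //.
by rewrite addr_ge0 // ltW.
Qed.
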